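(* For every $\alpha \in (0,1]$ there is a constant $c = c(\alpha)>0$ such that the following holds. Let $G$ be a finite abelian group and let $A \subset G$ be a symmetric set with $|A| \geq \alpha |G|$. Then there is a subgroup $H \leq G$ such that either $A = H$, or $$M_G(A) \geq c\,|A \triangle H|^{c}.$$
   Context: A subset $A$ of an abelian group $G$ is symmetric if $-x\in A$ whenever $x \in A$. $\triangle$ denotes symmetric difference. For a finite symmetric subset $A$ of a (discrete) abelian group $G$, let $\widehat{G}$ be the group of homomorphisms $\gamma: G \to S^1=\{z \in \mathbb{C}:|z|=1\}$, let $\widehat{1_A}(\gamma) = \sum_{x \in A}\overline{\gamma(x)}$ (which is real because $A$ is symmetric), and define $M_G(A) := \sup_{\gamma \in \widehat{G}} -\widehat{1_A}(\gamma)$. *)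

(* Defs.v *)
From HB Require Import structures.
From mathcomp Require Import all_boot all_order all_algebra all_fingroup.
From mathcomp Require Import complex.
From mathcomp Require Import classical_sets reals exp.

Set Implicit Arguments.
Unset Strict Implicit.
Unset Printing Implicit Defensive.

Import Order.TTheory GRing.Theory Num.Theory.

Local Open Scope classical_set_scope.
Local Open Scope ring_scope.

Definition symmetric_set (G : finZmodType) (A : {set G}) : Prop :=
  forall x : G, x \in A -> - x \in A.

Definition symdiff (T : finType) (A B : {set T}) : {set T} :=
  (A :\: B) :|: (B :\: A).

Definition is_character (R : realType) (G : finZmodType) (gamma : G -> R[i]) :
    Prop :=
  (forall x : G, `|gamma x| = 1) /\
  (forall x y : G, gamma (x + y) = gamma x * gamma y).

Definition dual_group (R : realType) (G : finZmodType) : set (G -> R[i]) :=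
  [set gamma | is_character gamma].
Arguments dual_group : clear implicits.

Definition fourier_indicator (R : realType) (G : finZmodType) (A : {set G})
    (gamma : G -> R[i]) : R[i] :=
  \sum_(x in A) (gamma x)^*%C.

(* [sup] lives in [R] whereas the transform is complex; taking the real part
   loses nothing for symmetric [A], see [fourier_indicator_real]. *)
Definition MG (R : realType) (G : finZmodType) (A : {set G}) : R :=
  sup [set - complex.Re (fourier_indicator A gamma)
      | gamma in dual_group R G].
Arguments MG R {G} A.

Lemma characterN (R : realType) (G : finZmodType) (gamma : G -> R[i]) (x : G) :
  is_character gamma -> gamma (- x) = (gamma x)^*%C.
Proof.
move=> [norm1 gammaD].
have nz y : gamma y != 0 by rewrite -normr_gt0 norm1 ltr01.
have gamma0 : gamma 0 = 1.
  by apply: (mulfI (nz 0)); rewrite -gammaD addr0 mulr1.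
apply: (mulfI (nz x)); rewrite -gammaD subrr gamma0.
by rewrite -[(gamma x)^*%C]/((gamma x)^*) -normCK norm1 expr1n.
Qed.

Lemma fourier_indicator_real (R : realType) (G : finZmodType) (A : {set G})
    (gamma : G -> R[i]) :
  symmetric_set A -> is_character gamma ->
  (complex.Re (fourier_indicator A gamma))%:C%C = fourier_indicator A gamma.
Proof.
move=> symA chi; apply: RRe_real; rewrite CrealE; apply/eqP.
rewrite /fourier_indicator rmorph_sum /= [RHS](reindex_inj oppr_inj) /=.
apply: eq_big => [x|x _]; last by rewrite characterN.
by apply/idP/idP => [/symA //|/symA]; rewrite opprK.
Qed.

(* Main.v *)
(** Let [N = #|G|], let [F] be the Fourier transform of [1_A] divided by [N], and
    write [M] for [MG A] (if [M <= 1/4] then [A] is a subgroup, because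
    [1_A + M delta_0] is positive definite).  From [1_A ^+ 2 = 1_A] one gets
    [F * F = F] on the dual group, while [- M / N <= F] and [\sum F <= 1].  Hence
    the positive part [P] of [F] satisfies [P * P <= P + O(M ^+ 2 / N)] and
    [\sum P <= 1 + M].  Passing repeatedly from a set [L] of characters to
    [L + L] squares both [#|L|] and [\sum_(L) P]; as the total mass is at most
    [1 + M], this forces [\sum_(L) P <= (1 + eta) #|L| `^ (1 / n)] as soon as [N]
    exceeds a fixed power of [1 + M].  Consequently a bounded number of characters
    carries almost all of the energy [\sum F ^+ 2 = a], with [a = #|A| / N], while
    its mass is nearly at most [1].  As [F <= a] pointwise, [F] takes only values
    close to [0] or to [a] there; those close to [a] form a subgroup [H'] of the
    dual with [#|H'| * a] close to [1], and [P >= P * P - O(M ^+ 2 / N)] summed over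
    cosets of [H'] makes [F] of size [O(M ^+ 2 / N)] off [H'].  By Parseval, [A]
    differs from the annihilator of [H'] in [O(M ^+ 4)] points.  If [N] is at most
    a fixed power of [1 + M], any subgroup will do. *)
Require Import Defs.
From HB Require Import structures.
From mathcomp Require Import all_boot all_order all_algebra all_fingroup.
From mathcomp Require Import separable cyclic algC cyclotomic classfun character.
From mathcomp Require Import complex.
From mathcomp Require Import classical_sets reals exp.
From mathcomp Require Import lra ring.

Set Implicit Arguments.
Unset Strict Implicit.
Unset Printing Implicit Defensive.

Import Order.TTheory GRing.Theory Num.Theory.

Local Open Scope ring_scope.

(** * Weights on a finite abelian group that nearly dominate their self-convolution *)

Section MassBound.
Variables (R : realType) (D : finZmodType) (P : D -> R) (s delta eta : R) (n : nat).
Hypothesis P_ge0 : forall x, 0 <= P x.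
Hypothesis PP : forall x, \sum_y P y * P (x - y) <= P x + delta.
Hypothesis P_sum : \sum_x P x <= s.
Hypothesis delta_ge0 : 0 <= delta.
Hypothesis eta_ge0 : 0 <= eta.
Hypothesis s_delta : s ^+ (2 * n) * delta <= eta.

Lemma mass_le (L : {set D}) : \sum_(x in L) P x <= s.
Proof.
apply: le_trans P_sum; rewrite [leRHS](bigID (mem L)) /= lerDl.
exact: sumr_ge0.
Qed.

Let dbl (L : {set D}) := [set p.1 + p.2 | p in finset.setX L L].

(** Each pair from [L] contributes to the convolution at its sum, a point of [dbl L]; the error
    [delta] is paid at most [#|L| ^ 2] times. *)
Lemma mass_dbl (L : {set D}) :
  (\sum_(x in L) P x) ^+ 2 <= \sum_(x in dbl L) P x + (#|L| ^ 2)%:R * delta.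
Proof.
have le1 : \sum_(x in dbl L) \sum_y P y * P (x - y)
    <= \sum_(x in dbl L) P x + (#|L| ^ 2)%:R * delta.
  apply: (@le_trans _ _ (\sum_(x in dbl L) (P x + delta))).
    exact: ler_sum.
  rewrite big_split /= lerD2l sumr_const -[_ *+ #|_|]mulr_natl ler_wpM2r //.
  by rewrite ler_nat (leq_trans (leq_imset_card _ _)) // cardsX.
apply: le_trans le1; rewrite exchange_big /= expr2 mulr_suml.
rewrite [leRHS](bigID (mem L)) /= -[leLHS]addr0 lerD //; last first.
  by apply: sumr_ge0 => y _; apply: sumr_ge0 => x _; rewrite mulr_ge0.
apply: ler_sum => y yL; rewrite -mulr_sumr ler_wpM2l //.
rewrite [leRHS](reindex_inj (addIr y)) /=.
under [leRHS]eq_bigr do rewrite addrK.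
rewrite [leRHS](bigID (mem L)) /= -[leLHS]addr0 lerD ?sumr_ge0 //.
rewrite [leRHS](eq_bigl (mem L)) // => x /=; apply/andP/idP => [[]//|xL].
by split=> //; apply/imsetP; exists (x, y); rewrite // inE xL.
Qed.

Lemma mass_bound (L : {set D}) (y : R) :
  1 < y -> #|L|%:R <= y ^+ n -> \sum_(x in L) P x <= (1 + eta) * y.
Proof.
move=> y1 Ly; rewrite leNgt; apply/negP => lt_sum.
(* If [L] violates the bound for [y], then [L + L] violates it for [y ^+ 2]; the
   violating values of [y] would be unbounded, although they are at most [s]. *)
have step (z : R) (K : {set D}) : 1 <= z -> #|K|%:R <= z ^+ n ->
    (1 + eta) * z <= \sum_(x in K) P x ->
    #|dbl K|%:R <= (z ^+ 2) ^+ n /\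
    (1 + eta) * z ^+ 2 <= \sum_(x in dbl K) P x.
  move=> z1 Kz sumK; have z0 : 0 <= z by apply: le_trans z1.
  have KK : (#|K| ^ 2)%:R <= z ^+ (2 * n).
    by rewrite natrX mulnC exprM lerXn2r ?nnegrE ?exprn_ge0.
  (* Masses never exceed [s], hence neither does [z], so [s_delta] controls the error at every
     iteration. *)
  have zs : z <= s.
    apply: le_trans (mass_le K); apply: le_trans sumK.
    by rewrite ler_peMl // lerDl.
  split.
    rewrite -exprM; apply: le_trans KK.
    by rewrite ler_nat (leq_trans (leq_imset_card _ _)) // cardsX.
  have err : (#|K| ^ 2)%:R * delta <= eta.
    apply: le_trans s_delta; rewrite ler_wpM2r // (le_trans KK) //.
    by rewrite lerXn2r // nnegrE (le_trans z0).
  have sq : ((1 + eta) * z) ^+ 2 <= (\sum_(x in K) P x) ^+ 2.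
    rewrite lerXn2r ?nnegrE ?sumr_ge0 //.
    by rewrite mulr_ge0 // addr_ge0.
  have z2 : 1 <= z ^+ 2 by rewrite expr_ge1.
  (* [(1 + eta) ^+ 2 * z ^+ 2 - eta] exceeds [(1 + eta) * z ^+ 2] by the sum of these two terms. *)
  have w1 : 0 <= eta * (z ^+ 2 - 1) by rewrite mulr_ge0 // subr_ge0.
  have w2 : 0 <= eta * eta * z ^+ 2 by rewrite !mulr_ge0 // exprn_ge0.
  have := le_trans sq (mass_dbl K); lra.
have jy j : 0 <= j%:R * (y - 1) by rewrite mulr_ge0 // subr_ge0 ltW.
have iter_ (j : nat) : exists (z : R) (K : {set D}), [/\ 1 + j%:R * (y - 1) <= z,
    #|K|%:R <= z ^+ n & (1 + eta) * z <= \sum_(x in K) P x].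
  elim: j => [|j [z [K [yz Kz sumK]]]].
    by exists y, L; split=> //; [rewrite mul0r addr0 ltW|exact: ltW].
  (* At [j = 0] the bound [1 <= z] does not grow under squaring, so [y] and [L] are taken again;
     afterwards [z ^+ 2 >= 2 * z - 1] at least doubles the gain. *)
  have [j0|j_gt0] := posnP j.
    exists y, L; split=> //; last exact: ltW.
    by rewrite j0 mul1r; lra.
  have jy1 : y - 1 <= j%:R * (y - 1).
    by rewrite ler_peMl ?ler1n // subr_ge0 ltW.
  have z1 : 1 <= z by have := jy j; lra.
  have [Kz' sumK'] := step z K z1 Kz sumK.
  exists (z ^+ 2), (dbl K); split=> //.
  rewrite -natr1 mulrDl mul1r; have := sqr_ge0 (z - 1); lra.
have s_ge0 : 0 <= s by have := mass_le finset.set0; rewrite big_set0.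
have [j sj] : exists j : nat, s < 1 + j%:R * (y - 1).
  exists (Num.bound (s / (y - 1))).
  have y1' : 0 < y - 1 by rewrite subr_gt0.
  have : s / (y - 1) < (Num.bound (s / (y - 1)))%:R.
    by rewrite archi_boundP // divr_ge0 // ltW.
  by rewrite ltr_pdivrMr //; lra.
have [z [K [jz _ sumK]]] := iter_ j.
have := mass_le K.
have : z <= (1 + eta) * z by rewrite ler_peMl ?lerDl //; have := jy j; lra.
lra.
Qed.
End MassBound.

Lemma sum_shift (V : zmodType) (D : finZmodType) (g : D -> V) (x : D) :
  \sum_z g (z - x) = \sum_z g z.
Proof. by rewrite [RHS](reindex_inj (addIr (- x))). Qed.

(** * Approximately nonnegative convolution idempotents *)

Section DualStructure.
Variables (R : realType) (D : finZmodType) (F : D -> R) (a M eta : R) (i0 n : nat).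
Let N : R := #|D|%:R.
Hypothesis F_even : forall x, F (- x) = F x.
Hypothesis F_conv : forall x, \sum_y F y * F (x - y) = F x.
Hypothesis F_ge : forall x, - (M / N) <= F x.
Hypothesis F_sum : \sum_x F x <= 1.
Hypothesis F0 : F 0 = a.
Hypothesis a_gt0 : 0 < a.
Hypothesis a_le1 : a <= 1.
Hypothesis M_ge0 : 0 <= M.
Hypothesis eta_gt0 : 0 < eta.
Hypothesis eta_le : eta <= a ^+ 2 / 400.
Hypothesis i0_large : 2^-1 ^+ i0 <= a ^+ 2 / 12800.
Hypothesis n_ge4 : (4 <= n)%N.
Hypothesis n_large : 16 ^+ i0 <= (1 + eta) ^+ n.
Let s := 1 + M.
Let delta := 2 * M * s / N.
Hypothesis N_large : s ^+ (2 * n) * delta <= eta.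
Let P x := Num.max (F x) 0.

Let N_gt0 : 0 < N.
Proof. by rewrite ltr0n; apply/card_gt0P; exists 0. Qed.

Let MN_ge0 : 0 <= M / N.
Proof. by rewrite divr_ge0 // ltW. Qed.

Let sumMN : \sum_(x : D) M / N = M.
Proof. by rewrite sumr_const -mulr_natr divfK // gt_eqF. Qed.

Let P_ge0 x : 0 <= P x.
Proof. by rewrite le_max lexx orbT. Qed.

Let F_le_P x : F x <= P x.
Proof. by rewrite le_max lexx. Qed.

Let P_le_F x : P x <= F x + M / N.
Proof. by have := F_ge x; have := MN_ge0; rewrite ge_max => *; apply/andP; split; lra. Qed.

Let P_sum : \sum_x P x <= s.
Proof.
apply: (@le_trans _ _ (\sum_x (F x + M / N))); first exact: ler_sum.
by rewrite big_split /= sumMN lerD2r.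
Qed.

Let delta_ge0 : 0 <= delta.
Proof. by rewrite /delta /s divr_ge0 ?(ltW N_gt0) // !mulr_ge0 // addr_ge0. Qed.

(** Added up, [h1], [h2] and [h3] compare the two products pointwise, also where both values of [F]
    are negative; summing over [y] costs [2 * s * M / N], which is [delta]. *)
Let P_conv x : \sum_y P y * P (x - y) <= P x + delta.
Proof.
have sumPx : \sum_y P (x - y) = \sum_y P y.
  by rewrite [RHS](reindex_inj (subrI x)).
apply: (@le_trans _ _ (\sum_y (F y * F (x - y) + M / N * (P y + P (x - y))))).
  apply: ler_sum => y _.
  have h1 : 0 <= P y * (F (x - y) + M / N - P (x - y)).
    by rewrite mulr_ge0 // subr_ge0.
  have h2 : 0 <= P (x - y) * (F y + M / N - P y) by rewrite mulr_ge0 // subr_ge0.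
  have h3 : 0 <= (P y - F y) * (P (x - y) - F (x - y)).
    by rewrite mulr_ge0 // subr_ge0.
  lra.
rewrite big_split /= F_conv -mulr_sumr big_split /= sumPx lerD //.
have -> : delta = M / N * (s + s) by rewrite /delta; field; rewrite gt_eqF.
by rewrite ler_wpM2l // lerD.
Qed.

Let F_energy : \sum_x F x ^+ 2 = a.
Proof.
rewrite -F0 -(F_conv 0); apply: eq_bigr => y _.
by rewrite sub0r F_even expr2.
Qed.

Let P_energy_le x : P x ^+ 2 <= F x ^+ 2.
Proof.
by rewrite /P /Num.max; case: ifP => // _; rewrite expr0n /= sqr_ge0.
Qed.

Let F_energy_le x : F x ^+ 2 <= P x ^+ 2 + (M / N) ^+ 2.
Proof.
rewrite /P /Num.max; case: ltP => Fx; last by rewrite lerDl sqr_ge0.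
by rewrite expr0n add0r -sqrrN lerXn2r ?nnegrE ?oppr_ge0 ?(ltW Fx) // lerNl.
Qed.

(** By evenness the cross term is the convolution at [x]. Thus [a - F x] acts as a squared distance:
    it is nonnegative and satisfies a triangle inequality up to a factor [2]. *)
Let shift_energy x : \sum_z (F z - F (z - x)) ^+ 2 = 2 * (a - F x).
Proof.
under eq_bigr => z _ do rewrite sqrrB.
rewrite big_split sumrB /= (sum_shift (fun z => F z ^+ 2)) F_energy.
under eq_bigr => z _ do rewrite -[F (z - x)]F_even opprB.
by rewrite sumrMnl F_conv; ring.
Qed.

Let F_le_a x : F x <= a.
Proof.
have : 0 <= \sum_z (F z - F (z - x)) ^+ 2 by apply: sumr_ge0 => z _; exact: sqr_ge0.
by rewrite shift_energy; lra.
Qed.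

Let defect_add x y : a - F (x + y) <= 2 * (a - F x) + 2 * (a - F y).
Proof.
have : \sum_z (F z - F (z - (x + y))) ^+ 2 <=
    \sum_z (2 * (F z - F (z - x)) ^+ 2 + 2 * (F (z - x) - F (z - x - y)) ^+ 2).
  apply: ler_sum => z _; rewrite opprD addrA.
  have := sqr_ge0 (F z - F (z - x) - (F (z - x) - F (z - x - y))); lra.
rewrite big_split /= -!mulr_sumr !shift_energy.
by rewrite (sum_shift (fun z => (F z - F (z - y)) ^+ 2)) shift_energy; lra.
Qed.

(** * Concentration of the energy on boundedly many points *)

Let P_mass (L : {set D}) (y : R) :
  1 < y -> #|L|%:R <= y ^+ n -> \sum_(x in L) P x <= (1 + eta) * y.
Proof.
move=> y1 Ly; apply: (mass_bound P_ge0 P_conv P_sum _ _ N_large) => //.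
exact: ltW.
Qed.

Let P_energy : \sum_x P x ^+ 2 <= 1.
Proof. by apply: le_trans a_le1; rewrite -F_energy; apply: ler_sum => x _. Qed.

Let P_set_energy (L : {set D}) : \sum_(x in L) P x ^+ 2 <= 1.
Proof.
apply: le_trans P_energy; rewrite [leRHS](bigID (mem L)) /= lerDl.
by apply: sumr_ge0 => x _; exact: sqr_ge0.
Qed.

Let eta_le1 : eta <= 1 / 400.
Proof.
have a2 : a ^+ 2 <= 1 by rewrite expr_le1 // ltW.
by apply: (le_trans eta_le); lra.
Qed.

(** Chebyshev's inequality for the energy, which is at most [1]. *)
Let card_level (i : nat) : #|[set x | 4^-1 ^+ i < P x]|%:R <= 16 ^+ i :> R.
Proof.
have : \sum_(x in [set x | 4^-1 ^+ i < P x]) (16^-1 ^+ i) <= 1 :> R.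
  apply: le_trans (P_set_energy [set x | 4^-1 ^+ i < P x]).
  apply: ler_sum => x; rewrite inE => Px.
  have -> : 16^-1 = 4^-1 ^+ 2 :> R by field.
  rewrite -exprM mulnC exprM; apply: lerXn2r; rewrite ?nnegrE ?P_ge0 ?ltW //.
  by rewrite exprn_gt0 // invr_gt0.
by rewrite sumr_const -(mulr_natl (_ ^+ i)) [16^-1 ^+ i]exprVn ler_pdivrMr ?mul1r // exprn_gt0.
Qed.

Let S := [set x | 4^-1 ^+ i0 < P x].

(** [n_large] allows [P_mass] to be used with [y = 1 + eta]. *)
Let S_mass : \sum_(x in S) P x <= (1 + eta) ^+ 2.
Proof.
by rewrite expr2; apply: P_mass; [rewrite ltrDl|exact: le_trans (card_level i0) n_large].
Qed.

(* The bound #|T| <= 16 ^+ i.+1 and [P_mass] with [y = 2 ^+ i.+1] improve the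
   trivial estimate of the energy on a dyadic level to a summable one. *)
Let dyadic_energy (i : nat) :
  \sum_(x | (P x <= 4^-1 ^+ i) && (4^-1 ^+ i.+1 < P x)) P x ^+ 2 <= 16 * 2^-1 ^+ i.
Proof.
pose T := [set x | (P x <= 4^-1 ^+ i) && (4^-1 ^+ i.+1 < P x)].
have T_card : #|T|%:R <= (2 ^+ i.+1) ^+ n :> R.
  apply: le_trans (_ : 16 ^+ i.+1 <= _).
    apply: le_trans (card_level i.+1); rewrite ler_nat subset_leq_card //.
    by apply/fintype.subsetP => x; rewrite !inE => /andP[].
  have -> : 16 = 2 ^+ 4 :> R by ring.
  rewrite -!exprM mulnC ler_eXn2l ?ltr1n // leq_mul2l n_ge4 orbT //.
have T_mass : \sum_(x in T) P x <= 2 * 2 ^+ i.+1.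
  apply: (@le_trans _ _ ((1 + eta) * 2 ^+ i.+1)).
    by apply: P_mass => //; rewrite exprn_egt1 // ltr1n.
  by rewrite ler_wpM2r ?exprn_ge0 //; have := eta_le1; lra.
apply: (@le_trans _ _ (\sum_(x in T) 4^-1 ^+ i * P x)).
  rewrite [leRHS](eq_bigl _ _ (fun x => finset.in_set _ x)) /=.
  by apply: ler_sum => x /andP[Px _]; rewrite expr2 ler_wpM2r.
rewrite -mulr_sumr.
apply: (@le_trans _ _ (4^-1 ^+ i * (2 * 2 ^+ i.+1))).
  by rewrite ler_wpM2l // exprn_ge0 // invr_ge0.
have -> : 4^-1 ^+ i = 2^-1 ^+ i * 2^-1 ^+ i :> R.
  by rewrite -exprMn; congr (_ ^+ _); field.
have : 2^-1 ^+ i * 2 ^+ i = 1 :> R by rewrite -exprMn mulVf ?expr1n ?pnatr_eq0.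
have : 0 <= 2^-1 ^+ i :> R by rewrite exprn_ge0 // invr_ge0.
rewrite exprS.
move: (2^-1 ^+ i) (2 ^+ i) => u v u0 uv.
have -> : u * u * (2 * (2 * v)) = 4 * u * (u * v) by ring.
by rewrite uv; lra.
Qed.

(** By [dyadic_energy], left side minus right side does not decrease with [i]. It is nonpositive at
    a level [j >= #|D|], where the trivial bound [4^-1 ^+ j] per point suffices. *)
Let tail_energy (i : nat) :
  \sum_(x | P x <= 4^-1 ^+ i) P x ^+ 2 <= 32 * 2^-1 ^+ i.
Proof.
have step j : \sum_(x | P x <= 4^-1 ^+ j) P x ^+ 2 - 32 * 2^-1 ^+ j
    <= \sum_(x | P x <= 4^-1 ^+ j.+1) P x ^+ 2 - 32 * 2^-1 ^+ j.+1.
  rewrite (bigID (fun x => 4^-1 ^+ j.+1 < P x)) /=.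
  have := dyadic_energy j; rewrite [2^-1 ^+ j.+1]exprS.
  rewrite [X in _ + X - _](eq_bigl (fun x => P x <= 4^-1 ^+ j.+1)); first by lra.
  move=> x; rewrite -leNgt andb_idl // => /le_trans; apply.
  by rewrite exprS ler_piMl ?exprn_ge0 ?invr_ge0 //; lra.
have steps k : \sum_(x | P x <= 4^-1 ^+ i) P x ^+ 2 - 32 * 2^-1 ^+ i
    <= \sum_(x | P x <= 4^-1 ^+ (i + k)) P x ^+ 2 - 32 * 2^-1 ^+ (i + k).
  elim: k => [|k IH]; first by rewrite addn0.
  by rewrite addnS; apply: le_trans IH _.
rewrite -subr_le0; apply: le_trans (steps #|D|) _.
move: (i + _)%N (leq_addl i #|D|) => j Dj; rewrite subr_le0.
apply: (@le_trans _ _ (\sum_(x : D) 4^-1 ^+ j)).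
  rewrite [leRHS](bigID (fun x => P x <= 4^-1 ^+ j)) /=.
  rewrite -[leLHS]addr0 lerD ?sumr_ge0 // => [|x _]; last by rewrite exprn_ge0 // invr_ge0.
  apply: ler_sum => x Px; rewrite expr2; apply: le_trans (_ : P x * 1 <= _).
    rewrite ler_wpM2l // (le_trans Px) // exprn_ile1 //; lra.
  by rewrite mulr1.
rewrite sumr_const -(mulr_natl (_ ^+ j)).
have : #|D|%:R * 2^-1 ^+ j <= 1 :> R.
  rewrite exprVn ler_pdivrMr ?exprn_gt0 // mul1r -natrX ler_nat.
  by rewrite (leq_trans Dj) // ltnW // ltn_expl.
have -> : 4^-1 ^+ j = 2^-1 ^+ j * 2^-1 ^+ j :> R.
  by rewrite -exprMn; congr (_ ^+ _); field.
have : 0 <= 2^-1 ^+ j :> R by rewrite exprn_ge0 // invr_ge0.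
rewrite mulrA => u0 /(ler_wpM2r u0); lra.
Qed.

Let tau_ge0 : 0 <= 4^-1 ^+ i0 :> R.
Proof. by rewrite exprn_ge0 // invr_ge0. Qed.

Let P_eq_F x : x \in S -> P x = F x.
Proof.
rewrite inE /P /Num.max; case: ifP => // _ lt0.
by have := le_lt_trans tau_ge0 lt0; rewrite ltxx.
Qed.

Let delta_le : delta <= eta.
Proof.
apply: le_trans N_large; rewrite ler_peMl // exprn_ege1 //.
by rewrite /s lerDl.
Qed.

Let negative_energy : \sum_(x : D) (M / N) ^+ 2 <= eta.
Proof.
apply: le_trans delta_le.
rewrite sumr_const -(mulr_natl (_ ^+ 2)) -/N.
have -> : N * (M / N) ^+ 2 = M * M / N by field; rewrite gt_eqF.
rewrite /delta /s ler_wpM2r ?invr_ge0 ?(ltW N_gt0) //.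
by have := M_ge0; have := mulr_ge0 M_ge0 M_ge0; lra.
Qed.

(** Since [32 / 12800 = 1 / 400], the tail of [P] and the negative part of [F] each account for at
    most [a ^+ 2 / 400]. *)
Let off_energy : \sum_(x | x \notin S) F x ^+ 2 <= a ^+ 2 / 200.
Proof.
apply: (@le_trans _ _ (\sum_(x | x \notin S) (P x ^+ 2 + (M / N) ^+ 2))).
  by apply: ler_sum => x _.
rewrite big_split /= (eq_bigl (fun x => P x <= 4^-1 ^+ i0)); last first.
  by move=> x; rewrite inE -leNgt.
have le2 : \sum_(x | x \notin S) (M / N) ^+ 2 <= eta.
  apply: le_trans negative_energy; rewrite [leRHS](bigID (mem S)) /= lerDr.
  by apply: sumr_ge0 => x _; exact: sqr_ge0.
by have := tail_energy i0; have := eta_le; have := i0_large; lra.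
Qed.

Let on_energy : a - a ^+ 2 / 200 <= \sum_(x in S) F x ^+ 2.
Proof.
by rewrite -{1}F_energy (bigID (mem S)) /=; have := off_energy; lra.
Qed.

Let S_mass_le : \sum_(x in S) F x <= 1 + a ^+ 2 / 100.
Proof.
rewrite -(eq_bigr _ P_eq_F); apply: le_trans S_mass _.
have : 0 <= eta * (1 - eta).
  by apply: mulr_ge0; [exact: ltW|have := eta_le1; lra].
have := sqr_ge0 a; have := eta_le; lra.
Qed.

(** On [S] the mass is at most about [1] and the energy at least about [a], so [a] times the mass
    barely exceeds the energy. As all terms are nonnegative, each [F x] on [S] is near [0] or
    [a]. *)
Let defect_sum : \sum_(x in S) F x * (a - F x) <= a ^+ 2 / 60.
Proof.
under eq_bigr do rewrite mulrBr -expr2 mulrC.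
rewrite sumrB -mulr_sumr.
have := ler_wpM2l (ltW a_gt0) S_mass_le.
have := on_energy.
have : a * (a ^+ 2) <= 1 * a ^+ 2 by rewrite ler_wpM2r // sqr_ge0.
have := sqr_ge0 a; lra.
Qed.

Let S_defect x : x \in S -> F x * (a - F x) <= a ^+ 2 / 60.
Proof.
move=> xS; apply: le_trans defect_sum; rewrite (bigD1 x) //= lerDl.
apply: sumr_ge0 => y /andP[yS _].
by rewrite mulr_ge0 ?subr_ge0 // -P_eq_F.
Qed.

(** * The subgroup of large coefficients *)

Let H := [set x | a / 2 <= F x].

Let H_sub_S x : x \in H -> x \in S.
Proof.
rewrite !inE => Fx; apply: lt_le_trans (F_le_P x); apply: lt_le_trans Fx.
apply: (@le_lt_trans _ _ (2^-1 ^+ i0)).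
  by apply: lerXn2r; rewrite ?nnegrE ?invr_ge0 //; lra.
have : a * a <= 1 * a by rewrite ler_wpM2r // ltW.
have := i0_large; have := a_gt0; rewrite expr2; lra.
Qed.

(** The values on [S] have a gap: once [F x >= a / 2], the defect [a - F x] is at most
    [(a ^+ 2 / 60) / (a / 2) = a / 30]. *)
Let H_large x : x \in H -> 29 / 30 * a <= F x.
Proof.
move=> xH; have := S_defect (H_sub_S xH); move: xH; rewrite inE => Fx d.
have : a / 2 * (a - F x) <= F x * (a - F x) by rewrite ler_wpM2r // subr_ge0.
move=> /le_trans/(_ d) d'.
have : a * (a - F x) <= a * (a / 30) by move: d'; rewrite expr2; lra.
by rewrite ler_pM2l //; lra.
Qed.

Let H0 : 0 \in H.
Proof. by rewrite inE F0; have := a_gt0; lra. Qed.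

(** Two defects of at most [a / 30] give one of at most [4 * (a / 30)], which is below [a / 2]. *)
Let HD x y : x \in H -> y \in H -> x + y \in H.
Proof.
move=> /H_large Fx /H_large Fy; rewrite inE.
by have := defect_add x y; have := a_gt0; lra.
Qed.

Let HN x : (- x \in H) = (x \in H).
Proof. by rewrite !inE F_even. Qed.

(** Energy count: below [a / 2] one has [F x ^+ 2 <= F x * (a - F x)], so [S] outside [H] carries
    little, and each point of [H] carries at most [a ^+ 2]. *)
Let H_card_ge : 19 / 20 <= #|H|%:R * a.
Proof.
have outH : \sum_(x in S | x \notin H) F x ^+ 2 <= a ^+ 2 / 60.
  apply: le_trans defect_sum.
  rewrite [leRHS](bigID (mem H)) /= -[leLHS]add0r lerD //.
    apply: sumr_ge0 => x /andP[xS _].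
    by rewrite mulr_ge0 ?subr_ge0 // -P_eq_F.
  apply: ler_sum => x /andP[xS]; rewrite inE -ltNge => Fx.
  by rewrite expr2 ler_wpM2l -?P_eq_F // P_eq_F //; lra.
have inH : \sum_(x in S | x \in H) F x ^+ 2 <= #|H|%:R * a ^+ 2.
  rewrite mulr_natl -sumr_const.
  rewrite (eq_bigl (mem H)); last by move=> x; rewrite andb_idl //; exact: H_sub_S.
  apply: ler_sum => x /H_sub_S xS; apply: lerXn2r; rewrite ?nnegrE ?(ltW a_gt0) //.
  by rewrite -P_eq_F.
have := on_energy; rewrite (bigID (mem H)) /= => en.
have a2 : a ^+ 2 <= a by rewrite expr2 ler_piMl // ltW.
have : 19 / 20 * a <= #|H|%:R * a * a by have := a_gt0; lra.
by rewrite ler_pM2r.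
Qed.

Let H_card_le : #|H|%:R * a <= 21 / 20.
Proof.
have : \sum_(x in H) (29 / 30 * a) <= \sum_(x in S) F x.
  rewrite [leRHS](bigID (mem H)) /= -[leLHS]addr0 lerD //; last first.
    by apply: sumr_ge0 => x /andP[xS _]; rewrite -P_eq_F.
  rewrite [leRHS](eq_bigl (mem H)); first exact: ler_sum.
  by move=> x; rewrite andb_idl //; exact: H_sub_S.
rewrite sumr_const -(mulr_natl (_ * a)).
have a2 : a ^+ 2 <= 1 by rewrite expr_le1 // ltW.
have := S_mass_le; lra.
Qed.

(** * Decay off the subgroup *)

Let Q x := \sum_(h in H) P (x - h).

Let Q_shift x h : h \in H -> Q (x - h) = Q x.
Proof.
move=> hH; rewrite /Q [RHS](reindex_inj (addrI h)) /=.
apply: eq_big => [k|k _]; last by rewrite opprD addrA.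
apply/idP/idP => [|hk]; first exact: HD.
by rewrite -[k](addKr h) HD // HN.
Qed.

(** [Q x] is the mass of the coset of [x]. Outside [H] the ranges [y \in H] and [x - y \in H] are
    disjoint, so this mass is counted twice: [29 / 15 = 2 * (29 / 30)]. *)
Let P_ge_Q x : x \notin H -> 29 / 15 * a * Q x <= P x + delta.
Proof.
move=> xH; apply: le_trans (P_conv x).
have disj y : y \in H -> x - y \notin H.
  by move=> yH; apply: contra xH => /HD/(_ yH); rewrite subrK.
have -> : 29 / 15 * a * Q x = 29 / 30 * a * Q x + 29 / 30 * a * Q x by lra.
rewrite [leRHS](bigID (mem H)) /= lerD //.
  rewrite mulr_sumr; apply: ler_sum => h hH; rewrite ler_wpM2r //.
  exact: le_trans (H_large hH) (F_le_P h).
rewrite [leRHS](reindex_inj (subrI x)) /=.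
rewrite [leRHS](bigID (mem H)) /= -[leLHS]addr0 lerD //; last first.
  by apply: sumr_ge0 => y _; rewrite mulr_ge0.
rewrite [leRHS](eq_bigl (mem H)); last first.
  by move=> y; rewrite /= andb_idl //; exact: disj.
rewrite mulr_sumr; apply: ler_sum => h hH; rewrite subKr.
by rewrite mulrC ler_wpM2l // (le_trans (H_large hH)).
Qed.

(** Summing [P_ge_Q] over the coset bounds [29 / 15 * (#|H|%:R * a) * Q x] by
    [Q x + #|H|%:R * delta]. Thanks to the double count the coefficient on the left exceeds [1], so
    [Q x] is absorbed. *)
Let Q_small x : x \notin H -> Q x <= 2 * #|H|%:R * delta.
Proof.
move=> xH.
have : \sum_(h in H) 29 / 15 * a * Q x <= \sum_(h in H) (P (x - h) + delta).
  apply: ler_sum => h hH; rewrite -(Q_shift x hH); apply: P_ge_Q.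
  by apply: contra xH => /HD/(_ hH); rewrite subrK.
rewrite big_split /= -/(Q x) !sumr_const -(mulr_natl (_ * Q x)) -(mulr_natl delta).
have Q0 : 0 <= Q x by apply: sumr_ge0 => h _.
have := ler_wpM2r Q0 H_card_ge; lra.
Qed.

Let F_off x : x \notin H -> N * `|F x| <= 6 * M * s / a.
Proof.
move=> xH.
have s1 : 1 <= s by rewrite /s lerDl.
have Ms : M <= M * s by rewrite ler_peMr.
have Ha : #|H|%:R <= 21 / 20 / a by rewrite ler_pdivlMr.
have PQ : P x <= Q x.
  rewrite /Q (bigD1 0) ?H0 //= subr0 lerDl.
  by apply: sumr_ge0 => h _.
have NP : N * P x <= 2 * (21 / 20 / a) * (2 * M * s).
  have -> : 2 * (21 / 20 / a) * (2 * M * s) = N * (2 * (21 / 20 / a) * delta).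
    by rewrite /delta; field; rewrite !gt_eqF.
  rewrite ler_wpM2l ?(ltW N_gt0) // (le_trans PQ) // (le_trans (Q_small xH)) //.
  by rewrite ler_wpM2r // ler_wpM2l.
have NF : N * `|F x| <= N * P x + M.
  have -> : N * P x + M = N * (P x + M / N) by field; rewrite gt_eqF.
  rewrite ler_wpM2l ?(ltW N_gt0) // ler_norml.
  by have := F_ge x; have := F_le_P x; have := P_ge0 x; have := MN_ge0; lra.
apply: (le_trans NF).
have M0 : 0 <= M * s by rewrite mulr_ge0 // (le_trans ler01).
have : M * s <= M * s / a by rewrite ler_peMr // invf_ge1.
have -> : 6 * M * s / a = 6 * (M * s / a) by ring.
have : 2 * (21 / 20 / a) * (2 * M * s) = 21 / 5 * (M * s / a) by field; rewrite gt_eqF.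
have : 0 <= M * s / a by rewrite divr_ge0 // ltW.
lra.
Qed.

Lemma dual_structure : [/\ 0 \in H, forall x y, x \in H -> y \in H -> x + y \in H,
  forall x, x \in H -> 29 / 30 * a <= F x <= a,
  19 / 20 <= #|H|%:R * a <= 21 / 20 &
  forall x, x \notin H -> N * `|F x| <= 6 * M * s / a].
Proof.
split=> // [x xH|]; first by apply/andP; split; [exact: H_large|].
by rewrite H_card_ge H_card_le.
Qed.

End DualStructure.

(** * The dual group *)

Section DualDef.
Variable G : finZmodType.
(** Writing [#|G|] as [#|G|.-1.+1] gives the ordinals the group structure of Z/|G|; the characters
    then form a [finZmodType], to which [dual_structure] applies. *)
Definition hom_pred : pred {ffun G -> 'I_#|G|.-1.+1} :=
  fun f => [forall x, forall y, f (x + y) == f x + f y].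

Fact hom_pred_closed : zmod_closed hom_pred.
Proof.
split=> [|f g /'forall_forallP fD /'forall_forallP gD].
  by apply/'forall_forallP => x y; rewrite !ffunE addr0.
apply/'forall_forallP => x y; rewrite !ffunE (eqP (fD x y)) (eqP (gD x y)).
by rewrite opprD addrACA.
Qed.
HB.instance Definition _ := GRing.isZmodClosed.Build _ hom_pred hom_pred_closed.

(* Characters are stored by their exponents: homomorphisms from [G] to Z/|G|,
   turned into complex-valued functions by [pairing] below. *)
Record dual : predArgType := Dual {dual_val : {ffun G -> 'I_#|G|.-1.+1}; _ : dual_val \in hom_pred}.
HB.instance Definition _ := [isSub for dual_val].
HB.instance Definition _ := [Finite of dual by <:].
HB.instance Definition _ := [SubChoice_isSubZmodule of dual by <:].

Lemma dualP (chi : dual) x y : dual_val chi (x + y) = dual_val chi x + dual_val chi y.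
Proof. by case: chi => f /= /'forall_forallP fD; apply/eqP/fD. Qed.

(** The irreducible characters over [algC] have trivial common kernel and, [G] being abelian, are
    linear with roots of unity as values. Only their exponents are kept, and these serve over any
    field with a primitive root. *)
Lemma dual_separates (x : G) : x != 0 -> exists chi : dual, dual_val chi x != 0.
Proof.
move=> x_neq0.
have oG : #|G|.-1.+1 = #|[set: G]| by rewrite cardsT prednK //; apply/card_gt0P; exists x.
have [z z_prim] := C_prim_root_exists (ltn0Sn #|G|.-1).
have [i x_ker] : exists i, x \notin cfker 'chi[[set: G]]_i.
  apply/existsP; apply: contraT => /existsPn all_ker; case/negP: x_neq0.
  have : x \in \bigcap_i cfker 'chi[[set: G]]_i.
    by apply/bigcapP => i _; have := all_ker i; rewrite negbK.
  by rewrite TI_cfker_irr inE.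
have lin : 'chi[[set: G]]_i \is a linear_char.
  by apply/char_abelianP; apply: FinRing.zmod_abelian.
have expo y : {k : 'I_#|G|.-1.+1 | 'chi[[set: G]]_i y = z ^+ k}.
  apply: (prim_rootP z_prim).
  by rewrite oG -lin_charX ?inE // expg_cardG ?inE // lin_char1.
pose f := [ffun y => sval (expo y)].
have fE y : 'chi[[set: G]]_i y = z ^+ f y by rewrite ffunE; case: (expo y).
have fD : f \in hom_pred.
  apply/'forall_forallP => u v; apply/eqP/val_inj => /=; apply/eqP.
  rewrite -[X in X == _](modn_small (ltn_ord (f (u + v)))).
  rewrite -(eq_prim_root_expr z_prim) -fE -FinRing.zmodMgE lin_charM ?inE //.
  by rewrite !fE exprD.
exists (Dual fD) => /=; apply: contra x_ker => /eqP fx0.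
by rewrite cfkerEirr !inE fE fx0 lin_char1 ?eqxx.
Qed.
End DualDef.

(** ['X^n - 1] splits with distinct roots. Over [R[i]] this turns the exponents into complex
    characters. *)
Lemma prim_root_exists (C : numClosedFieldType) (n : nat) :
  (0 < n)%N -> exists z : C, n.-primitive_root z.
Proof.
move=> n_gt0; have [r] := closed_field_poly_normal ('X^n - 1 : {poly C}).
rewrite lead_coefXnsubC // scale1r => Xn1E.
have r_roots : all n.-unity_root r.
  by apply/allP => z; rewrite -root_prod_XsubC -Xn1E.
have r_uniq : uniq r.
  by rewrite -separable_prod_XsubC -Xn1E separable_Xn_sub_1 // pnatr_eq0 -lt0n.
have r_size : (n <= size r)%N.
  by rewrite -ltnS -(size_prod_XsubC r id) -Xn1E size_XnsubC.
by have /hasP[z _ z_prim] := has_prim_root n_gt0 r_roots r_uniq r_size; exists z.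
Qed.

(** Translation by [x0] permutes [B] and multiplies the sum by [u x0]. Allowing any closed [B]
    covers both the full groups and the set [Hd] of large coefficients. *)
Lemma sum_nontrivial_character (C : idomainType) (X : finZmodType) (B : {set X}) (u : X -> C) :
  {morph u : x y / x + y >-> x * y} -> {in B &, forall x y, x + y \in B} ->
  (exists2 x, x \in B & u x != 1) -> \sum_(x in B) u x = 0.
Proof.
move=> uD BD [x0 x0B ux0]; apply/eqP.
have B_shift : [set x0 + x | x in B] = B.
  apply/eqP; rewrite eqEcard card_imset ?leqnn ?andbT; last exact: addrI.
  by apply/fintype.subsetP => _ /imsetP[x xB ->]; exact: BD.
have sumE : \sum_(x in B) u x = \sum_(x in B) u (x0 + x).
  by rewrite -{1}B_shift big_imset //= => x y _ _; exact: addrI.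
have : (1 - u x0) * \sum_(x in B) u x = 0.
  by rewrite mulrBl mul1r {1}sumE mulr_sumr -sumrB big1 // => x _; rewrite uD subrr.
by move=> /eqP; rewrite mulf_eq0 subr_eq0 eq_sym (negPf ux0).
Qed.

(** * Orthogonality relations *)

Section Fourier.
Variables (R : realType) (G : finZmodType) (zeta : R[i]).
Hypothesis zeta_prim : #|G|.-1.+1.-primitive_root zeta.
Local Notation D := (dual G).

Definition pairing (chi : D) (x : G) : R[i] := zeta ^+ dual_val chi x.

Lemma pairing_addl (x : G) : {morph pairing^~ x : chi psi / chi + psi >-> chi * psi}.
Proof.
move=> chi psi; rewrite /pairing -[dual_val (chi + psi)]/(val (chi + psi)) GRing.valD ffunE /=.
by rewrite (prim_expr_mod zeta_prim) exprD.
Qed.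

Lemma pairing_addr (chi : D) : {morph pairing chi : x y / x + y >-> x * y}.
Proof.
by move=> x y; rewrite /pairing dualP /= (prim_expr_mod zeta_prim) exprD.
Qed.

Lemma pairing_norm (chi : D) (x : G) : `|pairing chi x| = 1.
Proof.
apply/eqP; rewrite -(pexpr_eq1 (ltn0Sn #|G|.-1)) // -normrX /pairing.
by rewrite -exprM mulnC exprM (prim_expr_order zeta_prim) expr1n normr1.
Qed.

Lemma pairing_character (chi : D) : is_character (pairing chi).
Proof. by split; [exact: pairing_norm|exact: pairing_addr]. Qed.

Lemma pairing_eq1 (chi : D) (x : G) : (pairing chi x == 1) = (dual_val chi x == 0).
Proof.
rewrite -(expr0 zeta) (eq_prim_root_expr zeta_prim) mod0n modn_small //.
Qed.

Lemma pairing0l (x : G) : pairing 0 x = 1.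
Proof. by apply/eqP; rewrite pairing_eq1 -[dual_val 0]/(val (0 : D)) GRing.val0 ffunE. Qed.

Lemma pairing_suml (x : G) : x != 0 -> \sum_chi pairing chi x = 0.
Proof.
move=> x_neq0; have [chi chix] := dual_separates x_neq0.
have := sum_nontrivial_character (B := finset.setT) (pairing_addl x).
under eq_bigl do rewrite finset.in_setT; apply => [psi phi _ _|]; first by rewrite inE.
by exists chi; rewrite ?inE // pairing_eq1.
Qed.

Lemma pairing_sumr (chi : D) : chi != 0 -> \sum_x pairing chi x = 0.
Proof.
move=> chi_neq0; have := sum_nontrivial_character (B := finset.setT) (pairing_addr chi).
under eq_bigl do rewrite finset.in_setT; apply => [x y _ _|]; first by rewrite inE.
suff /existsP[x chix] : [exists x, dual_val chi x != 0].
  by exists x; rewrite ?inE // pairing_eq1.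
apply: contraR chi_neq0 => /existsPn chi0; apply/eqP/val_inj/ffunP => x.
by rewrite GRing.val0 ffunE; apply/eqP; have := chi0 x; rewrite negbK.
Qed.

Lemma pairing0r (chi : D) : pairing chi 0 = 1.
Proof.
have nz : pairing chi 0 != 0 by rewrite -normr_gt0 pairing_norm.
by apply: (mulfI nz); rewrite -pairing_addr addr0 mulr1.
Qed.

(** The sum of all pairings is evaluated in both orders; orthogonality leaves one nonzero inner sum
    in each. *)
Lemma card_dual : #|D| = #|G|.
Proof.
suff : #|D|%:R = #|G|%:R :> R[i] by move=> /eqP; rewrite eqr_nat => /eqP.
transitivity (\sum_x \sum_(chi : D) pairing chi x).
  rewrite (bigD1 0) //= [X in _ + X]big1 ?addr0.
    by under eq_bigr do rewrite pairing0r; rewrite sumr_const.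
  by move=> x; exact: pairing_suml.
rewrite exchange_big (bigD1 0) //= [X in _ + X]big1 ?addr0.
  by under eq_bigr do rewrite pairing0l; rewrite sumr_const.
by move=> chi; exact: pairing_sumr.
Qed.

Lemma pairing_sumlE (x : G) : \sum_chi pairing chi x = #|G|%:R * (x == 0)%:R.
Proof.
have [->|/pairing_suml ->] := eqVneq x 0; last by rewrite mulr0.
by under eq_bigr do rewrite pairing0r; rewrite sumr_const card_dual mulr1.
Qed.

Lemma pairingNl (chi : D) (x : G) : pairing (- chi) x = pairing chi (- x).
Proof.
have nz : pairing chi x != 0 by rewrite -normr_gt0 pairing_norm.
by apply: (mulfI nz); rewrite -pairing_addl -pairing_addr !subrr pairing0l pairing0r.
Qed.
End Fourier.

(** * Fourier coefficients of a symmetric set *)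

Lemma ReD (R : realType) : {morph @complex.Re R : z w / z + w >-> z + w}.
Proof. by case=> a b [c d]. Qed.

Lemma Re_sum (R : realType) (I : finType) (P : pred I) (z : I -> R[i]) :
  complex.Re (\sum_(i | P i) z i) = \sum_(i | P i) complex.Re (z i).
Proof. exact: (big_morph (@complex.Re R) (@ReD R)). Qed.

Lemma ReZ (R : realType) (r : R) (z : R[i]) : complex.Re (r%:C%C * z) = r * complex.Re z.
Proof. by case: z => a b /=; rewrite mul0r subr0. Qed.

Lemma Re2_Im2_unit (R : realType) (z : R[i]) :
  `|z| = 1 -> complex.Re z ^+ 2 + complex.Im z ^+ 2 = 1.
Proof. by move=> z1; apply: (@complexI R); rewrite add_Re2_Im2 z1 expr1n. Qed.

Lemma Re_unit_le1 (R : realType) (z : R[i]) : `|z| = 1 -> complex.Re z <= 1.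
Proof.
by move/Re2_Im2_unit; have := sqr_ge0 (complex.Im z); have := sqr_ge0 (complex.Re z - 1); lra.
Qed.

(** As [2 * (1 - Re z) = |1 - z|^2] on the unit circle, this is a squared triangle inequality; it
    amounts to [|z + w^* - 2|^2 >= 0]. *)
Lemma Re_unit_mul (R : realType) (z w : R[i]) : `|z| = 1 -> `|w| = 1 ->
  1 - complex.Re (z * w) <= 2 * (1 - complex.Re z) + 2 * (1 - complex.Re w).
Proof.
move=> /Re2_Im2_unit z1 /Re2_Im2_unit w1; case: z w z1 w1 => a b [c d] /= z1 w1.
have := sqr_ge0 (a + c - 2); have := sqr_ge0 (b - d); lra.
Qed.

Lemma neg_fourier_le_MG (R : realType) (G : finZmodType) (A : {set G}) (gamma : G -> R[i]) :
  is_character gamma -> - complex.Re (fourier_indicator A gamma) <= MG R A.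
Proof.
move=> chi; apply: ub_le_sup; last by exists gamma.
(* [sup] dominates its elements only when the set is bounded above; [#|A|] is such a bound. *)
exists #|A|%:R => _ [psi [psi1 _] <-]; rewrite /fourier_indicator Re_sum -sumrN.
rewrite -sumr_const; apply: ler_sum => x _.
have := Re2_Im2_unit (psi1 x); case: (psi x) => a b /=.
have := sqr_ge0 (a + 1); have := sqr_ge0 b; lra.
Qed.

Section FourierCoefficients.
Variables (R : realType) (G : finZmodType) (A : {set G}) (zeta : R[i]).
Hypothesis zeta_prim : #|G|.-1.+1.-primitive_root zeta.
Hypothesis symA : symmetric_set A.
Local Notation D := (dual G).
Local Notation e := (pairing zeta).

(** Dividing by [#|G|] makes the coefficients idempotent under convolution and their value at [0]
    the density of [A]. *)
Definition fcoef (chi : D) : R := complex.Re (fourier_indicator A (e chi)) / #|G|%:R.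

Let N_gt0 : 0 < #|G|%:R :> R.
Proof. by rewrite ltr0n; apply/card_gt0P; exists 0. Qed.

Let N_neq0 : #|G|%:R != 0 :> R[i].
Proof. by rewrite pnatr_eq0 -lt0n; apply/card_gt0P; exists 0. Qed.

Lemma symA_oppr x : (- x \in A) = (x \in A).
Proof. by apply/idP/idP => [/symA|/symA //]; rewrite opprK. Qed.

Lemma sum_symA (V : zmodType) (g : G -> V) : \sum_(x in A) g (- x) = \sum_(x in A) g x.
Proof.
by rewrite [RHS](reindex_inj oppr_inj); apply: eq_bigl => x; rewrite symA_oppr.
Qed.

Lemma fcoefE (chi : D) : (fcoef chi)%:C%C = (\sum_(x in A) e chi x) / #|G|%:R.
Proof.
rewrite /fcoef fmorph_div rmorph_nat /=; congr (_ / _).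
rewrite fourier_indicator_real //; last exact: pairing_character.
rewrite -[RHS]sum_symA; apply: eq_bigr => x _.
by rewrite (characterN x (pairing_character zeta_prim chi)).
Qed.

Lemma fcoefN (chi : D) : fcoef (- chi) = fcoef chi.
Proof.
apply: (@complexI R); rewrite !fcoefE -[in RHS]sum_symA; congr (_ / _).
by apply: eq_bigr => x _; rewrite pairingNl.
Qed.

Lemma fcoef0 : fcoef 0 = #|A|%:R / #|G|%:R.
Proof.
apply: (@complexI R); rewrite fcoefE fmorph_div !rmorph_nat.
by under eq_bigr do rewrite pairing0l //; rewrite sumr_const.
Qed.

(** This is the transform of [1_A ^ 2 = 1_A]: the sum over [psi] forces [x = y] in the double sum
    over [A]. *)
Lemma fcoef_conv (chi : D) : \sum_psi fcoef psi * fcoef (chi - psi) = fcoef chi.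
Proof.
apply: (@complexI R); rewrite rmorph_sum /=.
transitivity (\sum_(psi : D) \sum_(x in A) \sum_(y in A)
    e chi y / #|G|%:R / #|G|%:R * e psi (x - y)).
  apply: eq_bigr => psi _; rewrite rmorphM /= !fcoefE mulrACA mulr_suml mulr_suml.
  apply: eq_bigr => x _; rewrite mulr_sumr mulr_suml; apply: eq_bigr => y _.
  by rewrite (pairing_addl zeta_prim) (pairing_addr zeta_prim) (pairingNl zeta_prim); field; rewrite N_neq0.
rewrite exchange_big fcoefE mulr_suml; apply: eq_bigr => x xA.
rewrite exchange_big /= (bigD1 x) //= -mulr_sumr (pairing_sumlE zeta_prim) subrr eqxx mulr1.
rewrite divfK // big1 ?addr0 // => y /andP[_ yx].
by rewrite -mulr_sumr (pairing_sumlE zeta_prim) subr_eq0 eq_sym (negPf yx) !mulr0.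
Qed.

Lemma fcoef_inversion (x : G) : \sum_chi fcoef chi * complex.Re (e chi x) = (x \in A)%:R.
Proof.
under eq_bigr do rewrite -ReZ fcoefE.
rewrite -Re_sum.
have -> : \sum_(chi : D) (\sum_(y in A) e chi y) / #|G|%:R * e chi x =
    \sum_(y in A) #|G|%:R^-1 * \sum_chi e chi (y + x).
  under [RHS]eq_bigr do rewrite mulr_sumr.
  rewrite exchange_big; apply: eq_bigr => chi _; rewrite mulr_suml mulr_suml.
  by apply: eq_bigr => y _; rewrite (pairing_addr zeta_prim); ring.
under eq_bigr do rewrite (pairing_sumlE zeta_prim) mulKf // addr_eq0.
rewrite -symA_oppr; have [xA|xA] := boolP (- x \in A); last first.
  by rewrite big1 // => y yA; case: eqVneq => // yx; rewrite -yx yA in xA.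
rewrite (bigD1 (- x)) //= eqxx big1 ?addr0 // => y /andP[_ /negPf ->] //.
Qed.

Lemma fcoef_ge (M : R) : MG R A <= M -> forall chi, - (M / #|G|%:R) <= fcoef chi.
Proof.
move=> MGM chi; rewrite lerNl /fcoef -mulNr ler_pM2r ?invr_gt0 //.
exact: le_trans (neg_fourier_le_MG _ (pairing_character zeta_prim chi)) MGM.
Qed.

(** Parseval's identity becomes an inequality because the imaginary part of the inverse transform is
    dropped. *)
Lemma parseval_le (c : D -> R) :
  \sum_x (\sum_chi c chi * complex.Re (e chi x)) ^+ 2 <= #|G|%:R * \sum_chi c chi ^+ 2.
Proof.
pose z x := \sum_chi (c chi)%:C%C * e chi x.
have -> : #|G|%:R * \sum_chi c chi ^+ 2 = complex.Re (\sum_x z x * (z x)^*%C).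
  have -> : \sum_x z x * (z x)^*%C =
      \sum_(chi : D) \sum_(psi : D) (c chi * c psi)%:C%C * \sum_x e (chi - psi) x.
    under [RHS]eq_bigr => chi _ do under eq_bigr => psi _ do rewrite mulr_sumr.
    under [RHS]eq_bigr => chi _ do rewrite exchange_big.
    rewrite [RHS]exchange_big; apply: eq_bigr => x _.
    rewrite /z rmorph_sum /= mulr_suml; apply: eq_bigr => chi _.
    rewrite mulr_sumr; apply: eq_bigr => psi _.
    have -> : ((c psi)%:C * e psi x)^*%C = (c psi)%:C%C * (e psi x)^*%C.
      by rewrite -[in RHS]conjc_real; exact: rmorphM.
    rewrite rmorphM /= -(characterN x (pairing_character zeta_prim psi)).
    by rewrite (pairing_addl zeta_prim) (pairingNl zeta_prim); ring.
  rewrite Re_sum mulr_sumr; apply: eq_bigr => chi _.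
  rewrite (bigD1 chi) //= [X in _ + X]big1 ?addr0.
    rewrite ReZ subrr; under eq_bigr do rewrite pairing0l //.
    by rewrite sumr_const -(rmorph_nat (real_complex R)) /= mulrC expr2.
  by move=> psi psichi; rewrite (pairing_sumr zeta_prim) ?mulr0 // subr_eq0 eq_sym.
rewrite Re_sum; apply: ler_sum => x _.
under eq_bigr do rewrite -ReZ.
rewrite -Re_sum -/(z x); case: (z x) => a b /=.
by have := sqr_ge0 b; lra.
Qed.
End FourierCoefficients.

(** * Back to the group *)

Section GroupSide.
Variables (R : realType) (G : finZmodType) (A : {set G}) (zeta : R[i]).
Hypothesis zeta_prim : #|G|.-1.+1.-primitive_root zeta.
Hypothesis symA : symmetric_set A.
Local Notation D := (dual G).
Local Notation e := (pairing zeta).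
Local Notation F := (fcoef A zeta).

Let N_gt0 : 0 < #|G|%:R :> R.
Proof. by rewrite ltr0n; apply/card_gt0P; exists 0. Qed.

(** The weights are the Fourier coefficients of [1_A + M delta_0], so the sum is the value of this
    function at [0] minus its value at [x]. *)
Lemma weighted_defect (M : R) (x : G) :
  \sum_chi (F chi + M / #|G|%:R) * (1 - complex.Re (e chi x)) =
  (0 \in A)%:R - (x \in A)%:R + M * (1 - (x == 0)%:R).
Proof.
have sumRe : \sum_chi complex.Re (e chi x) = #|G|%:R * (x == 0)%:R.
  by rewrite -Re_sum (pairing_sumlE zeta_prim) -natrM -(rmorph_nat (real_complex R)) /= natrM.
have sumF : \sum_chi F chi = (0 \in A)%:R.
  rewrite -(fcoef_inversion zeta_prim symA); apply: eq_bigr => chi _.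
  by rewrite (pairing0r zeta_prim) mulr1.
transitivity (\sum_chi (F chi - F chi * complex.Re (e chi x) +
    M / #|G|%:R * (1 - complex.Re (e chi x)))).
  by apply: eq_bigr => chi _; ring.
rewrite big_split /= -mulr_sumr !sumrB sumF (fcoef_inversion zeta_prim symA) sumRe.
rewrite sumr_const (card_dual zeta_prim).
by field; rewrite gt_eqF.
Qed.

(** Once [0 \in A], [Z] is at most [1 / 4] on [A] and equals [5 / 4] off [A], whereas [ZD] allows at
    most [1] at a sum of two points of [A]. Closure suffices since [G] is finite. *)
Lemma group_of_small_MG : MG R A <= 1 / 4 -> (0 < #|A|)%N -> group_set A.
Proof.
move=> MGle /card_gt0P[x0 x0A].
pose Z x := \sum_chi (F chi + 1 / 4 / #|G|%:R) * (1 - complex.Re (e chi x)).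
have w_ge0 chi : 0 <= F chi + 1 / 4 / #|G|%:R.
  by have := fcoef_ge zeta_prim MGle chi; lra.
have Z_ge0 x : 0 <= Z x.
  apply: sumr_ge0 => chi _; rewrite mulr_ge0 // subr_ge0 Re_unit_le1 //.
  exact: pairing_norm.
have ZE x : Z x = (0 \in A)%:R - (x \in A)%:R + 1 / 4 * (1 - (x == 0)%:R).
  exact: weighted_defect.
have ZD x y : Z (x + y) <= 2 * Z x + 2 * Z y.
  rewrite /Z !mulr_sumr -big_split /=; apply: ler_sum => chi _.
  have := Re_unit_mul (pairing_norm zeta_prim chi x) (pairing_norm zeta_prim chi y).
  rewrite -(pairing_addr zeta_prim) => /(ler_wpM2l (w_ge0 chi)); lra.
have A0 : 0 \in A.
  apply: contraT => A0; have := Z_ge0 x0; rewrite ZE x0A (negPf A0).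
  by case: (x0 == 0) => /=; lra.
apply/group_setP; split=> // x y xA yA; rewrite FinRing.zmodMgE.
have small z : z \in A -> Z z <= 1 / 4.
  by move=> zA; rewrite ZE zA A0; case: (z == 0) => /=; lra.
apply: contraT => xyA; have := ZD x y; have := small x xA; have := small y yA.
rewrite [Z (x + y)]ZE A0 (negPf xyA).
have [xy0|_] := eqVneq; first by rewrite xy0 A0 in xyA.
by move=> /=; lra.
Qed.

Section Structure.
Variables (M eta : R) (i0 n : nat).
Let a : R := #|A|%:R / #|G|%:R.
Hypothesis MG_le : MG R A <= M.
Hypothesis A_gt0 : (0 < #|A|)%N.
Hypothesis M_ge0 : 0 <= M.
Hypothesis eta_gt0 : 0 < eta.
Hypothesis eta_le : eta <= a ^+ 2 / 400.
Hypothesis i0_large : 2^-1 ^+ i0 <= a ^+ 2 / 12800.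
Hypothesis n_ge4 : (4 <= n)%N.
Hypothesis n_large : 16 ^+ i0 <= (1 + eta) ^+ n.
Hypothesis G_large : (1 + M) ^+ (2 * n) * (2 * M * (1 + M) / #|G|%:R) <= eta.

Let a_gt0 : 0 < a.
Proof. by rewrite divr_gt0 // ltr0n. Qed.

Let a_le1 : a <= 1.
Proof. by rewrite ler_pdivrMr // mul1r ler_nat max_card. Qed.

Let Hd : {set D} := [set chi | a / 2 <= F chi].

Let annihilator : {set G} := [set x | [forall chi in Hd, e chi x == 1]].

Let annihilator_group : group_set annihilator.
Proof.
apply/group_setP; split=> [|x y]; rewrite !inE.
  by apply/forall_inP => chi _; rewrite (pairing0r zeta_prim).
move=> /forall_inP ex /forall_inP ey; apply/forall_inP => chi chiH.
by rewrite FinRing.zmodMgE (pairing_addr zeta_prim) (eqP (ex _ chiH)) (eqP (ey _ chiH)) mulr1.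
Qed.

(** The part of the Fourier series of [1_A] over [Hd] approximates the indicator of the annihilator.
    The remainder [g] satisfies [g x ^+ 2 >= 1 / 4] on the symmetric difference, and Parseval with
    the bound off [Hd] limits the number of such points. *)
Lemma near_subgroup :
  exists H : {group G}, #|symdiff A H|%:R <= 4 * (6 * M * (1 + M) / a) ^+ 2.
Proof.
have DG := card_dual zeta_prim.
have Fconv := fcoef_conv zeta_prim symA.
have Fge chi : - (M / #|D|%:R) <= F chi by rewrite DG; exact: fcoef_ge.
have Fsum : \sum_chi F chi <= 1.
  have -> : \sum_chi F chi = (0 \in A)%:R.
    rewrite -(fcoef_inversion zeta_prim symA); apply: eq_bigr => chi _.
    by rewrite (pairing0r zeta_prim) mulr1.
  by case: (0 \in A).
have F0 : F 0 = a by rewrite (fcoef0 zeta_prim symA).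
have GD : (1 + M) ^+ (2 * n) * (2 * M * (1 + M) / #|D|%:R) <= eta by rewrite DG.
have [H0 HD Hval /andP[Hge Hle] Hoff] := dual_structure (fcoefN zeta_prim symA)
  Fconv Fge Fsum F0 a_gt0 a_le1 M_ge0 eta_gt0 eta_le i0_large n_ge4 n_large GD.
rewrite -/Hd in H0 HD Hval Hge Hle Hoff.
exists (Group annihilator_group); rewrite /=.
pose c chi := if chi \in Hd then 0 else F chi.
pose g x := \sum_chi c chi * complex.Re (e chi x).
have gE x : g x = (x \in A)%:R - \sum_(chi in Hd) F chi * complex.Re (e chi x).
  rewrite -(fcoef_inversion zeta_prim symA) [X in X - _](bigID (mem Hd)) /= [X in _ = X - _]addrC addrK.
  rewrite /g (bigID (mem Hd)) /= big1 ?add0r => [|chi chiH]; last by rewrite /c chiH mul0r.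
  by apply: eq_bigr => chi /negPf chiH; rewrite /c chiH.
have g_large x : x \in symdiff A annihilator -> 1 / 4 <= g x ^+ 2.
  rewrite !/symdiff !inE => /orP[/andP[xK xA]|/andP[xA xK]].
    suff : 1 / 2 <= g x by have := sqr_ge0 (g x - 1 / 2); lra.
    rewrite gE xA.
    have [chi0 chi0H echi0] : exists2 chi0, chi0 \in Hd & e chi0 x != 1.
      by move: xK => /forall_inPn[chi0 chi0H echi0]; exists chi0.
    have sum0 : \sum_(chi in Hd) e chi x = 0.
      apply: sum_nontrivial_character (pairing_addl zeta_prim x) HD _.
      by exists chi0.
    have sumRe0 : \sum_(chi in Hd) complex.Re (e chi x) = 0 by rewrite -Re_sum sum0.
    (* As [a - F chi] lies between [0] and [a / 30], replacing [F chi] by [a] costs at most [a / 30]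
       per character; the remaining character sum vanishes. *)
    have : \sum_(chi in Hd) F chi * complex.Re (e chi x) <=
        \sum_(chi in Hd) (a / 30 + a * complex.Re (e chi x)).
      apply: ler_sum => chi chiH; have /andP[F1 F2] := Hval _ chiH.
      have /Re2_Im2_unit := pairing_norm zeta_prim chi x.
      have := sqr_ge0 (complex.Im (e chi x)) => i2 ri1.
      have : - complex.Re (e chi x) <= 1 by have := sqr_ge0 (complex.Re (e chi x) + 1); lra.
      have Fa : 0 <= a - F chi by rewrite subr_ge0.
      by move=> /(ler_wpM2l Fa); lra.
    by rewrite big_split /= sumr_const -(mulr_natl (_ / _)) -mulr_sumr sumRe0 /=; lra.
  suff : g x <= - (1 / 2) by have := sqr_ge0 (g x + 1 / 2); lra.
  rewrite gE (negPf xA).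
  have : \sum_(chi in Hd) (29 / 30 * a) <= \sum_(chi in Hd) F chi * complex.Re (e chi x).
    apply: ler_sum => chi chiH; have /andP[F1 _] := Hval _ chiH.
    by move: xK => /forall_inP/(_ _ chiH)/eqP -> /=; rewrite mulr1.
  by rewrite sumr_const -(mulr_natl (_ * a)) /=; lra.
have : \sum_(x in symdiff A annihilator) (1 / 4 : R) <= \sum_x g x ^+ 2.
  rewrite [leRHS](bigID (mem (symdiff A annihilator))) /= -[leLHS]addr0 lerD //.
    exact: ler_sum.
  by apply: sumr_ge0 => x _; exact: sqr_ge0.
move=> /le_trans/(_ (parseval_le zeta_prim c)).
rewrite sumr_const -(mulr_natl (_ / _)).
have : #|G|%:R * \sum_chi c chi ^+ 2 <= (6 * M * (1 + M) / a) ^+ 2.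
  rewrite mulr_sumr.
  have : \sum_chi #|G|%:R * c chi ^+ 2 <= \sum_(chi : D) (6 * M * (1 + M) / a) ^+ 2 / #|G|%:R.
    apply: ler_sum => chi _; rewrite ler_pdivlMr //.
    have -> : #|G|%:R * c chi ^+ 2 * #|G|%:R = (#|G|%:R * `|c chi|) ^+ 2.
      by rewrite exprMn real_normK ?num_real //; ring.
    apply: lerXn2r; rewrite ?nnegrE ?mulr_ge0 ?(ltW N_gt0) ?invr_ge0 ?(ltW a_gt0) ?addr_ge0 //.
    rewrite /c; case: ifPn => chiH; last by rewrite -DG; exact: Hoff.
    by rewrite normr0 mulr0 divr_ge0 ?(ltW a_gt0) // !mulr_ge0 // addr_ge0.
  by rewrite sumr_const DG -(mulr_natl (_ / _)) mulrCA divff ?gt_eqF // mulr1.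
lra.
Qed.
End Structure.
End GroupSide.

(** * Choice of constants and conclusion *)

Lemma powR_of_polynomial_bound (R : realType) (K : R) (p : nat) : 0 <= K -> (0 < p)%N ->
  exists c : R, 0 < c /\
    forall (T : nat) (M : R), 0 <= M -> T%:R <= K * M ^+ p -> c * (T%:R `^ c) <= M.
Proof.
(* One constant has two roles: as a factor it is at most [(K + 1)^-1], as an exponent at most
   [p%:R^-1]. *)
move=> K0 p0; exists ((K + 1) * p%:R)^-1.
have pR : 0 < p%:R :> R by rewrite ltr0n.
have K1 : 0 < K + 1 by rewrite ltr_wpDl.
have c0 : 0 < ((K + 1) * p%:R)^-1 by rewrite invr_gt0 mulr_gt0.
(* [T = 0] is treated apart, since powers increase with the exponent only for bases at least [1]. *)
split=> // T M M0; case: T => [|T] TM.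
  by rewrite powR0 ?mulr0 // gt_eqF.
set t : R := T.+1%:R in TM *.
have t1 : 1 <= t by rewrite ler1n.
have c_le : ((K + 1) * p%:R)^-1 <= p%:R^-1.
  by rewrite lef_pV2 ?posrE ?mulr_gt0 // ler_peMl ?(ltW pR) // lerDr.
have root_le : t `^ p%:R^-1 <= (K + 1) * M.
  rewrite -(@ler_pXn2r _ p) ?nnegrE ?powR_ge0 ?mulr_ge0 ?(ltW K1) //.
  rewrite -powR_mulrn ?powR_ge0 // -powRrM mulVf ?gt_eqF // powRr1 ?(le_trans ler01) //.
  apply: (le_trans TM); rewrite exprMn ler_wpM2r ?exprn_ge0 //.
  apply: (@le_trans _ _ (K + 1)); first by rewrite lerDl.
  by rewrite ler_eXnr // lerDr.
have le1 : t `^ ((K + 1) * p%:R)^-1 <= (K + 1) * M.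
  by apply: le_trans root_le; apply: ler_powR.
apply: (@le_trans _ _ ((K + 1)^-1 * ((K + 1) * M))); last by rewrite mulKf ?gt_eqF.
apply: ler_pM; rewrite ?powR_ge0 ?(ltW c0) //.
by rewrite lef_pV2 ?posrE ?mulr_gt0 // ler_peMr ?(ltW K1) // ler1n.
Qed.

Lemma expn_unbounded (R : realType) (x y : R) : 0 < x -> exists m : nat, y <= (1 + x) ^+ m.
Proof.
move=> x0; exists (Num.bound (`|y| / x)).
have : `|y| / x < (Num.bound (`|y| / x))%:R by rewrite archi_boundP // divr_ge0 // ltW.
rewrite ltr_pdivrMr // => ltm; apply: (le_trans (ler_norm y)).
apply: (le_trans (ltW ltm)); elim: (Num.bound _) => [|m IH]; first by rewrite mul0r.
have : (1 + x) ^+ m * x >= x by rewrite ler_peMl ?(ltW x0) // exprn_ege1 // lerDl ltW.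
by rewrite exprS -natr1; lra.
Qed.

(** Used with [b = alpha ^+ 2], so that [i0] and [n] depend on [alpha] only. *)
Lemma parameters_exist (R : realType) (b : R) : 0 < b -> exists i0 n : nat,
  [/\ 2^-1 ^+ i0 <= b / 12800, (4 <= n)%N & 16 ^+ i0 <= (1 + b / 400) ^+ n].
Proof.
move=> b0; have [i0 i0P] := expn_unbounded (12800 / b) (@ltr01 R).
have b400 : 0 < b / 400 by rewrite divr_gt0.
have [m mP] := expn_unbounded (16 ^+ i0) b400; exists i0, (m + 4)%N; split.
- rewrite exprVn -[leRHS]invrK lef_pV2 ?posrE ?exprn_gt0 ?invr_gt0 ?divr_gt0 //.
  by rewrite invf_div.
- exact: leq_addl.
- by apply: (le_trans mP); rewrite ler_weXn2l ?leq_addr // lerDl ltW.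
Qed.

(** From [M >= 1 / 4] follow [1 + M <= 5 * M] and [M ^+ 4 <= (4 * M) ^+ p]; the constant is
    [3600 = 4 * 30 ^ 2]. *)
Lemma large_group_bound (R : realType) (alpha a M : R) (p : nat) :
  0 < alpha -> alpha <= a -> 1 / 4 <= M -> (4 <= p)%N ->
  4 * (6 * M * (1 + M) / a) ^+ 2 <= 3600 / alpha ^+ 2 * 4 ^+ p * M ^+ p.
Proof.
move=> alpha_gt0 a_ge M_large p4.
have a_gt0 : 0 < a by apply: lt_le_trans a_ge.
have M_ge0 : 0 <= M by lra.
have s_le : M * (1 + M) <= M * (5 * M) by rewrite ler_wpM2l //; lra.
have num_ge0 : 0 <= 6 * M * (1 + M) by rewrite !mulr_ge0 // addr_ge0.
have base : 6 * M * (1 + M) / a <= 30 * M ^+ 2 / alpha.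
  by apply: ler_pM; rewrite ?invr_ge0 ?(ltW a_gt0) ?lef_pV2 ?posrE //; lra.
have sq : (6 * M * (1 + M) / a) ^+ 2 <= (30 * M ^+ 2 / alpha) ^+ 2.
  apply: lerXn2r; rewrite ?nnegrE // ?divr_ge0 ?(ltW a_gt0) ?(ltW alpha_gt0) //.
  by rewrite mulr_ge0 // sqr_ge0.
have M4 : M ^+ 4 <= 4 ^+ p * M ^+ p.
  rewrite -exprMn; apply: (@le_trans _ _ ((4 * M) ^+ 4)).
    by apply: lerXn2r; rewrite ?nnegrE ?mulr_ge0 //; lra.
  by apply: ler_weXn2l => //; lra.
have sqE : (30 * M ^+ 2 / alpha) ^+ 2 = 900 / alpha ^+ 2 * M ^+ 4.
  by field; rewrite gt_eqF.
have C_ge0 : 0 <= 3600 / alpha ^+ 2 by rewrite divr_ge0 // sqr_ge0.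
rewrite sqE in sq; have := ler_wpM2l C_ge0 M4; rewrite mulrA; lra.
Qed.

(** If the largeness condition of [near_subgroup] fails, the order of the group is itself bounded by
    a power of [M]. *)
Lemma small_group_bound (R : realType) (eta M N : R) (n : nat) :
  0 < eta -> 0 < N -> 1 / 4 <= M ->
  eta < (1 + M) ^+ (2 * n) * (2 * M * (1 + M) / N) ->
  N <= 2 / eta * 5 ^+ (2 * n).+2 * M ^+ (2 * n).+2.
Proof.
move=> eta_gt0 N_gt0 M_large G_small; have M_ge0 : 0 <= M by lra.
have s_le : 1 + M <= 5 * M by lra.
have -> : 2 / eta * 5 ^+ (2 * n).+2 * M ^+ (2 * n).+2 =
    (5 * M) ^+ (2 * n) * (2 * (5 * M) * (5 * M)) / eta.
  by rewrite exprMn !exprS; ring.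
rewrite ler_pdivlMr // mulrC -ler_pdivlMr //; apply: (le_trans (ltW G_small)).
rewrite mulrA ler_pM2r ?invr_gt0 //.
apply: ler_pM; rewrite ?exprn_ge0 ?mulr_ge0 ?addr_ge0 //.
  by apply: lerXn2r; rewrite ?nnegrE ?mulr_ge0 ?addr_ge0.
by apply: ler_pM; rewrite ?mulr_ge0 ?addr_ge0 //; lra.
Qed.

Theorem theorem1p3 (R : realType) (alpha : R) (halpha : 0 < alpha <= 1) :
  exists c : R, 0 < c /\
    forall (G : finZmodType) (A : {set G}),
      symmetric_set A ->
      alpha * (#|G|)%:R <= (#|A|)%:R ->
      exists H : {group G},
        A = H \/ c * ((#|symdiff A H|)%:R `^ c) <= MG R A.
Proof.
have /andP[alpha_gt0 _] := halpha.
have alpha2_gt0 : 0 < alpha ^+ 2 by rewrite exprn_gt0.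
have [i0 [n [i0P n_ge4 nP]]] := parameters_exist alpha2_gt0.
have eta_gt0 : 0 < alpha ^+ 2 / 400 by rewrite divr_gt0.
(* [eta] is defined from [alpha], not from the density of [A], so that [c] is uniform; the equation
   keeps it opaque. *)
have [eta etaE] : exists eta, eta = alpha ^+ 2 / 400 by exists (alpha ^+ 2 / 400).
rewrite -etaE in eta_gt0 nP.
have K1_ge0 : 0 <= 3600 / alpha ^+ 2 * 4 ^+ (2 * n).+2.
  by rewrite mulr_ge0 ?exprn_ge0 // divr_ge0 ?sqr_ge0.
have K2_ge0 : 0 <= 2 / eta * 5 ^+ (2 * n).+2.
  by rewrite mulr_ge0 ?exprn_ge0 // divr_ge0 // ltW.
(* The exponent [2 * n + 2] comes from the small groups and is at least the [4] needed for large
   ones; the sum of the two constants covers both cases. *)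
have [c [c_gt0 c_bound]] :=
  powR_of_polynomial_bound (addr_ge0 K1_ge0 K2_ge0) (ltn0Sn (2 * n).+1).
exists c; split=> // G A symA A_dense.
have [zeta zeta_prim] := prim_root_exists R[i] (ltn0Sn #|G|.-1).
have G_gt0 : 0 < #|G|%:R :> R by rewrite ltr0n; apply/card_gt0P; exists 0.
have A_gt0 : (0 < #|A|)%N.
  by rewrite -(ltr0n R); apply: lt_le_trans A_dense; rewrite mulr_gt0.
have [MG_small|/ltW MG_large] := leP (MG R A) (1 / 4).
  by exists (Group (group_of_small_MG zeta_prim symA MG_small A_gt0)); left.
have M_ge0 : 0 <= MG R A by apply: le_trans MG_large; rewrite divr_ge0.
have Mp_ge0 : 0 <= MG R A ^+ (2 * n).+2 by rewrite exprn_ge0.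
pose K := 3600 / alpha ^+ 2 * 4 ^+ (2 * n).+2 + 2 / eta * 5 ^+ (2 * n).+2.
suff [H H_near] : exists H : {group G}, #|symdiff A H|%:R <= K * MG R A ^+ (2 * n).+2.
  by exists H; right; exact: c_bound.
have a_ge : alpha <= #|A|%:R / #|G|%:R by rewrite ler_pdivlMr.
have a2_ge : alpha ^+ 2 <= (#|A|%:R / #|G|%:R) ^+ 2.
  by apply: lerXn2r; rewrite ?nnegrE ?(le_trans (ltW alpha_gt0)) ?(ltW alpha_gt0).
have [G_large|G_small] :=
    leP ((1 + MG R A) ^+ (2 * n) * (2 * MG R A * (1 + MG R A) / #|G|%:R)) eta.
  have eta_le : eta <= (#|A|%:R / #|G|%:R) ^+ 2 / 400 by rewrite etaE ler_wpM2r ?invr_ge0 ?ler0n.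
  have i0_le : 2^-1 ^+ i0 <= (#|A|%:R / #|G|%:R) ^+ 2 / 12800 :> R.
    by apply: (le_trans i0P); rewrite ler_wpM2r ?invr_ge0 ?ler0n.
  have [H H_near] := near_subgroup zeta_prim symA (lexx _) A_gt0 M_ge0 eta_gt0
    eta_le i0_le n_ge4 nP G_large.
  exists H; apply: (le_trans H_near); rewrite /K [leRHS]mulrDl.
  apply: (ler_wpDr (mulr_ge0 K2_ge0 Mp_ge0)).
  apply: large_group_bound alpha_gt0 a_ge MG_large _; apply: leq_trans n_ge4 _.
  by rewrite mul2n -addnn -addn2 -addnA leq_addr.
(* In a small group any symmetric difference has few enough points, so the trivial subgroup
   serves. *)
exists [1 G]%G; apply: (@le_trans _ _ #|G|%:R); first by rewrite ler_nat max_card.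
rewrite /K [leRHS]mulrDl.
apply: (ler_wpDl (mulr_ge0 K1_ge0 Mp_ge0)); exact: small_group_bound G_small.
Qed.
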